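(* Let $\mathbb{C}$ be a co-Boolean category. Then every object of $\mathbb{C}$ is projection-coextensive.
   Context: A product projection of $X$ is a morphism $X\to A$ that is one of the two legs of some binary product diagram $A\leftarrow X\to A'$. A category $\mathbb{C}$ with finite products is co-Boolean if: (1) for every product projection $p:X\to A$ and any morphism $f:X\to Y$ there exists a pushout of $p$ along $f$, with pushout object $P$, such that the resulting morphism $q:Y\to P$ is a product projection; (2) product projections push out product diagrams to product diagrams, i.e. if $A_1\leftarrow X\to A_2$ is a product diagram and $f:X\to Y$ is a product projection, then pushing out both legs along $f$ yields a product diagram $P_1\leftarrow Y\to P_2$; (3) if $X\xleftarrow{1_X}X\xrightarrow{1_X}X$ is a product diagram, then $X$ is a terminal object. For a class $\mathcal{M}$ of morphisms, an $\mathcal{M}$-pushout is a pushout square whose two morphisms into the pushout object belong to $\mathcal{M}$. An object $X$ is $\mathcal{M}$-coextensive if every morphism in $\mathcal{M}$ with domain $X$ admits an $\mathcal{M}$-pushout along every product projection of $X$, and for every commutative diagram consisting of a product diagram $A_1\leftarrow X\to A_2$ (top row), a bottom row $B_1\leftarrow Y\to B_2$, and vertical morphisms $A_1\to B_1$, $X\to Y$, $A_2\to B_2$ all in $\mathcal{M}$, the bottom row is a product diagram if and only if both squares are $\mathcal{M}$-pushouts. $X$ is projection-coextensive if it is $\mathcal{M}$-coextensive with $\mathcal{M}$ the class of all product projections in $\mathbb{C}$. *)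

(* Defs.v *)
From mathcomp Require Import all_boot.

Set Implicit Arguments.
Unset Strict Implicit.
Unset Printing Implicit Defensive.

Declare Scope cat_scope.
Delimit Scope cat_scope with cat.
Local Open Scope cat_scope.

Record category := Category {
  obj :> Type;
  hom : obj -> obj -> Type;
  idm : forall X, hom X X;
  comp : forall X Y Z, hom Y Z -> hom X Y -> hom X Z;
  comp_idl : forall X Y (f : hom X Y), comp (idm Y) f = f;
  comp_idr : forall X Y (f : hom X Y), comp f (idm X) = f;
  compA : forall W X Y Z (h : hom Y Z) (g : hom X Y) (f : hom W X),
    comp h (comp g f) = comp (comp h g) f
}.

Arguments hom {c} X Y.
Arguments idm {c} X.

Notation "g \o f" := (comp g f) : cat_scope.

Definition is_terminal (C : category) (T : C) : Prop :=
  forall W : C, exists! u : hom W T, True.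

Definition is_family_product (C : category) (I : Type) (F : I -> C) (X : C)
    (p : forall i, hom X (F i)) : Prop :=
  forall (W : C) (f : forall i, hom W (F i)),
    exists! u : hom W X, forall i, p i \o u = f i.

Definition has_finite_products (C : category) : Prop :=
  forall (I : finType) (F : I -> C),
    exists (X : C) (p : forall i, hom X (F i)), is_family_product p.

Definition is_product (C : category) (X A1 A2 : C)
    (p1 : hom X A1) (p2 : hom X A2) : Prop :=
  forall (W : C) (f1 : hom W A1) (f2 : hom W A2),
    exists! u : hom W X, p1 \o u = f1 /\ p2 \o u = f2.

(* The square
       X --f--> Y
       |p       |q
       A --r--> P                                                            *)
Definition is_pushout (C : category) (X A Y P : C)
    (p : hom X A) (f : hom X Y) (r : hom A P) (q : hom Y P) : Prop :=
  r \o p = q \o f /\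
  forall (Z : C) (a : hom A Z) (y : hom Y Z), a \o p = y \o f ->
    exists! u : hom P Z, u \o r = a /\ u \o q = y.

Definition morphism_class (C : category) := forall X Y : C, hom X Y -> Prop.

Definition product_projection (C : category) : morphism_class C :=
  fun X A p => exists (A' : C) (p' : hom X A'), is_product p p'.

Record co_boolean (C : category) : Prop := CoBoolean {
  cob_finite_products : has_finite_products C;
  cob_pushout : forall (X A Y : C) (p : hom X A) (f : hom X Y),
    product_projection p ->
    exists (P : C) (r : hom A P) (q : hom Y P),
      is_pushout p f r q /\ product_projection q;
  cob_product : forall (X A1 A2 Y P1 P2 : C)
      (p1 : hom X A1) (p2 : hom X A2) (f : hom X Y)
      (r1 : hom A1 P1) (q1 : hom Y P1) (r2 : hom A2 P2) (q2 : hom Y P2),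
    is_product p1 p2 -> product_projection f ->
    is_pushout p1 f r1 q1 -> is_pushout p2 f r2 q2 ->
    is_product q1 q2;
  cob_terminal : forall X : C, is_product (idm X) (idm X) -> is_terminal X
}.

Definition is_M_pushout (C : category) (M : morphism_class C) (X A Y P : C)
    (p : hom X A) (f : hom X Y) (r : hom A P) (q : hom Y P) : Prop :=
  [/\ is_pushout p f r q, M _ _ r & M _ _ q].

(* In the second clause the bottom row q1, q2 is arbitrary: only the vertical
   morphisms are required to lie in M.                                       *)
Definition coextensive (C : category) (M : morphism_class C) (X : C) : Prop :=
  (forall (Y A : C) (f : hom X Y) (p : hom X A),
     M _ _ f -> product_projection p ->
     exists (P : C) (r : hom A P) (q : hom Y P), is_M_pushout M p f r q)
  /\
  (forall (A1 A2 Y B1 B2 : C) (p1 : hom X A1) (p2 : hom X A2)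
      (q1 : hom Y B1) (q2 : hom Y B2)
      (a1 : hom A1 B1) (f : hom X Y) (a2 : hom A2 B2),
     is_product p1 p2 ->
     M _ _ a1 -> M _ _ f -> M _ _ a2 ->
     a1 \o p1 = q1 \o f -> a2 \o p2 = q2 \o f ->
     (is_product q1 q2 <->
      is_M_pushout M p1 f a1 q1 /\ is_M_pushout M p2 f a2 q2)).

Definition projection_coextensive (C : category) (X : C) : Prop :=
  coextensive (@product_projection C) X.

(* Main.v *)
From mathcomp Require Import all_boot.
Require Import Defs.

Set Implicit Arguments.
Unset Strict Implicit.
Unset Printing Implicit Defensive.

Local Open Scope cat_scope.

(** Pushing a product diagram [A <- X -> A'] out along its own legs shows, as in
    Manes' Boolean categories, that product projections are epimorphisms and
    that the pushout of two complementary projections is terminal.  Given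
    vertical projections from [A1 <- X -> A2] to a product diagram
    [B1 <- Y -> B2], let [P1 <- Y -> P2] be the product diagram obtained by
    pushing out along [X -> Y], with comparison morphisms [Pi -> Bi].  Pushing
    [B1 <- Y -> B2] out along [Y -> P1] gives a product diagram
    [B1 <- P1 -> E].  Since [P1] and [P2] push out to a terminal [T], [E] is the
    pushout of [P2 -> T] along [P2 -> B2]; so [B2 <- B2 -> E] is a product
    diagram, which makes [E] terminal and [P1 -> B1] invertible. *)

Section Category.
Variable C : category.

Definition epi (X Y : C) (p : hom X Y) : Prop :=
  forall (Z : C) (a b : hom Y Z), a \o p = b \o p -> a = b.

Lemma product_hom_ext (X A1 A2 W : C) (p1 : hom X A1) (p2 : hom X A2)
    (a b : hom W X) :
  is_product p1 p2 -> p1 \o a = p1 \o b -> p2 \o a = p2 \o b -> a = b.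
Proof.
move=> prod e1 e2.
have [u [_ uU]] := prod _ (p1 \o b) (p2 \o b).
by rewrite -(uU a) // -(uU b).
Qed.

Lemma is_product_sym (X A1 A2 : C) (p1 : hom X A1) (p2 : hom X A2) :
  is_product p1 p2 -> is_product p2 p1.
Proof.
move=> prod W f1 f2; have [u [[u1 u2] uU]] := prod W f2 f1.
by exists u; split=> // v [v1 v2]; apply: uU.
Qed.

Lemma product_projectionl (X A1 A2 : C) (p1 : hom X A1) (p2 : hom X A2) :
  is_product p1 p2 -> product_projection p1.
Proof. by move=> prod; exists A2, p2. Qed.

Lemma product_projectionr (X A1 A2 : C) (p1 : hom X A1) (p2 : hom X A2) :
  is_product p1 p2 -> product_projection p2.
Proof. by move/is_product_sym/product_projectionl. Qed.

Lemma terminal_hom_ext (T W : C) (a b : hom W T) : is_terminal T -> a = b.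
Proof.
by move=> term; have [u [_ uU]] := term W; rewrite -(uU a) // -(uU b).
Qed.

Lemma product_id_terminal (X T : C) (t : hom X T) :
  is_terminal T -> is_product (idm X) t.
Proof.
move=> term W f1 f2; exists f1; split=> [|v [<- _]]; last by rewrite comp_idl.
by rewrite comp_idl; split=> //; apply: terminal_hom_ext.
Qed.

Lemma product_terminal_iso (X A T : C) (p : hom X A) (t : hom X T) :
  is_product p t -> is_terminal T ->
  exists2 v : hom A X, p \o v = idm A & v \o p = idm X.
Proof.
move=> prod term; have [w _] := term A.
have [v [[pv _] _]] := prod A (idm A) w.
exists v => //; apply: (product_hom_ext prod); last exact: terminal_hom_ext.
by rewrite compA pv comp_idl comp_idr.
Qed.

Lemma is_pushout_sym (X A Y P : C) (p : hom X A) (f : hom X Y)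
    (r : hom A P) (q : hom Y P) :
  is_pushout p f r q -> is_pushout f p q r.
Proof.
move=> [comm univ]; split=> // Z a y e.
have [u [[u1 u2] uU]] := univ Z y a (esym e).
by exists u; split=> // v [v1 v2]; apply: uU.
Qed.

Lemma is_pushout_id (X Y : C) (f : hom X Y) : is_pushout (idm X) f f (idm Y).
Proof.
split=> [|Z a y]; first by rewrite comp_idl comp_idr.
rewrite comp_idr => ->; exists y; split=> [|v [_ <-]]; last by rewrite comp_idr.
by rewrite comp_idr.
Qed.

(** Cancelling [s] in the cocone equation leaves [a \o u = y], so [a] itself is the mediating
    morphism. *)
Lemma is_pushout_epi (X Y Z : C) (s : hom X Y) (u : hom Y Z) :
  epi s -> is_pushout (u \o s) s (idm Z) u.
Proof.
move=> epi_s; split=> [|W a y]; first by rewrite comp_idl.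
rewrite compA => /epi_s ay; exists a.
by split=> [|v [<- _]]; rewrite comp_idr.
Qed.

Lemma is_pushout_paste (X A Y P Y' P' : C) (p : hom X A) (f : hom X Y)
    (r : hom A P) (q : hom Y P) (g : hom Y Y') (r' : hom P P')
    (q' : hom Y' P') :
  is_pushout p f r q -> is_pushout q g r' q' ->
  is_pushout p (g \o f) (r' \o r) q'.
Proof.
move=> [comm univ] [comm' univ']; split=> [|Z a y].
  by rewrite -compA comm !compA comm'.
rewrite compA => e.
have [u [[ur uq] uU]] := univ Z a (y \o g) e.
have [v [[vr vq] vU]] := univ' Z u y uq.
exists v; split=> [|w [wr wq]]; first by rewrite compA vr.
apply: vU; split=> //; apply/esym/uU; split; first by rewrite -compA.
by rewrite -compA comm' compA wq.
Qed.

Lemma is_pushout_iso (X A Y P Q : C) (p : hom X A) (f : hom X Y)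
    (r : hom A P) (q : hom Y P) (u : hom P Q) (v : hom Q P) :
  u \o v = idm Q -> v \o u = idm P ->
  is_pushout p f r q -> is_pushout p f (u \o r) (u \o q).
Proof.
move=> uv vu [comm univ]; split=> [|Z a y e]; first by rewrite -!compA comm.
have [h [[hr hq] hU]] := univ Z a y e.
have vuK (W : C) (k : hom W P) : v \o (u \o k) = k by rewrite compA vu comp_idl.
exists (h \o v); split=> [|w [wr wq]]; first by rewrite -!compA !vuK.
rewrite (hU (w \o u)); last by rewrite -!compA.
by rewrite -compA uv comp_idr.
Qed.

Section CoBoolean.
Hypothesis hC : co_boolean C.

Lemma terminal_split_product (Q E1 E2 : C) (e1 : hom Q E1) (e2 : hom Q E2)
    (d1 : hom E1 Q) (d2 : hom E2 Q) :
  is_product e1 e2 -> d1 \o e1 = idm Q -> d2 \o e2 = idm Q -> is_terminal Q.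
Proof.
move=> prod d1e1 d2e2.
(* Any [a], [b] into [Q] are both equal to the morphism with components
   [e1 \o a] and [e2 \o b]. *)
have hom_ext (W : C) (a b : hom W Q) : a = b.
  have [w [[w1 w2] _]] := prod W (e1 \o a) (e2 \o b).
  have: d1 \o (e1 \o w) = d1 \o (e1 \o a) by rewrite w1.
  have: d2 \o (e2 \o w) = d2 \o (e2 \o b) by rewrite w2.
  by rewrite !compA d1e1 d2e2 !comp_idl => -> ->.
apply: (cob_terminal hC) => W a b; exists a; split=> [|v _].
  by split; apply: hom_ext.
exact: hom_ext.
Qed.

(** Pushing out a complement of [p] along [f] completes [q] to a product diagram, whichever pushout
    square is given. *)
Lemma pushout_projection (X A Y P : C) (p : hom X A) (f : hom X Y)
    (r : hom A P) (q : hom Y P) :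
  product_projection p -> product_projection f -> is_pushout p f r q ->
  product_projection q.
Proof.
move=> [A' [p' prod]] proj_f po.
have [P' [r' [q' [po' _]]]] :=
  cob_pushout hC f (product_projectionr prod).
exact: product_projectionl (cob_product hC prod proj_f po po').
Qed.

Lemma complementary_pushout_terminal (X A A' Q : C) (p : hom X A)
    (p' : hom X A') (j : hom A Q) (j' : hom A' Q) :
  is_product p p' -> is_pushout p p' j j' -> is_terminal Q.
Proof.
move=> prod po; have proj_p := product_projectionl prod.
have [P [k1 [k2 [kpo _]]]] := cob_pushout hC p proj_p.
have [d [[_ dk2] _]] := kpo.2 A (idm A) (idm A) erefl.
(* Pushing [A <- X -> A'] out along [p] itself makes [A] a product of [P] and [Q]; the codiagonal
   [d] retracts [k2]. *)
have prodk := cob_product hC prod proj_p kpo (is_pushout_sym po).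
have proj_k := product_projectionl prodk.
have proj_j := product_projectionr prodk.
(* Push [P <- A -> Q] out along [j]. Both legs out of [Q] are split: the first since [j \o d]
   extends [j] along [k2], the second by a codiagonal. *)
have [E1 [r1 [e1 [po1 _]]]] := cob_pushout hC j proj_k.
have [E2 [r2 [e2 [po2 _]]]] := cob_pushout hC j proj_j.
have [|d1 [[_ d1e1] _]] := po1.2 Q (j \o d) (idm Q).
  by rewrite -compA dk2 comp_idl comp_idr.
have [d2 [[_ d2e2] _]] := po2.2 Q (idm Q) (idm Q) erefl.
exact: terminal_split_product (cob_product hC prodk proj_j po1 po2) d1e1 d2e2.
Qed.

(** The cokernel pair [k1], [k2] of [p] is trivial: [A] is the product of [P] with a terminal
    object, so [k2] is invertible with inverse the codiagonal [d], and [d \o k1 = idm A] forces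
    [k1 = k2]. *)
Lemma product_projection_epi (X A : C) (p : hom X A) :
  product_projection p -> epi p.
Proof.
move=> proj_p; have [A' [p' prod]] := proj_p.
have [P [k1 [k2 [kpo _]]]] := cob_pushout hC p proj_p.
have [Q [j [j' [po _]]]] := cob_pushout hC p' proj_p.
have term := complementary_pushout_terminal prod po.
have prodk := cob_product hC prod proj_p kpo (is_pushout_sym po).
have [d [[dk1 dk2] _]] := kpo.2 A (idm A) (idm A) erefl.
have [s k2s _] := product_terminal_iso prodk term.
have ds : d = s by rewrite -[d]comp_idr -k2s compA dk2 comp_idl.
have k12 : k1 = k2.
  by rewrite -[LHS]comp_idl -k2s -ds -compA dk1 comp_idr.
by move=> Z a b /kpo.2 [u [[<- <-] _]]; rewrite k12.
Qed.

Lemma product_refinement_iso (Y P1 P2 B1 B2 : C) (s1 : hom Y P1)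
    (s2 : hom Y P2) (u1 : hom P1 B1) (u2 : hom P2 B2) :
  is_product s1 s2 -> is_product (u1 \o s1) (u2 \o s2) ->
  exists2 v : hom B1 P1, u1 \o v = idm B1 & v \o u1 = idm P1.
Proof.
move=> prods prodq.
have proj_s1 := product_projectionl prods.
have proj_s2 := product_projectionr prods.
(* [u2] is the pushout of the projection [u2 \o s2] along the epimorphism [s2]. *)
have proj_u2 : product_projection u2.
  have po := is_pushout_epi u2 (product_projection_epi proj_s2).
  exact: pushout_projection (product_projectionr prodq) proj_s2 po.
have [T [t1 [t2 [tpo _]]]] := cob_pushout hC s2 proj_s1.
have prodt := product_id_terminal t2 (complementary_pushout_terminal prods tpo).
have [E [r [g [gpo _]]]] := cob_pushout hC u2 (product_projectionr prodt).
have prodg := cob_product hC prodt proj_u2 (is_pushout_id u2) gpo.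
(* The pushout of [idm B2] and [g] is [E] itself. *)
have termE := complementary_pushout_terminal prodg (is_pushout_id g).
(* Pasting exhibits [E] as the pushout of [u2 \o s2] along [s1]; that of [u1 \o s1] is [B1], so [P1]
   is a product of [B1] and the terminal [E]. *)
have epo := is_pushout_sym (is_pushout_paste tpo gpo).
apply: product_terminal_iso termE.
apply: (cob_product hC prodq proj_s1 _ epo).
exact: is_pushout_epi (product_projection_epi proj_s1).
Qed.

(** The given bottom row factors through the pushed-out product row, so the comparison [u1] is
    invertible and carries the pushout square to the given one. *)
Lemma product_square_pushout (X A1 A2 Y B1 B2 : C) (p1 : hom X A1)
    (p2 : hom X A2) (q1 : hom Y B1) (q2 : hom Y B2) (a1 : hom A1 B1)
    (f : hom X Y) (a2 : hom A2 B2) :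
  is_product p1 p2 -> product_projection f ->
  a1 \o p1 = q1 \o f -> a2 \o p2 = q2 \o f -> is_product q1 q2 ->
  is_pushout p1 f a1 q1.
Proof.
move=> prodp proj_f e1 e2 prodq.
have [P1 [r1 [s1 [po1 _]]]] := cob_pushout hC f (product_projectionl prodp).
have [P2 [r2 [s2 [po2 _]]]] := cob_pushout hC f (product_projectionr prodp).
have prods := cob_product hC prodp proj_f po1 po2.
have [u1 [[ur1 us1] _]] := po1.2 _ _ _ e1.
have [u2 [[_ us2] _]] := po2.2 _ _ _ e2.
rewrite -us1 -us2 in prodq.
have [v uv vu] := product_refinement_iso prods prodq.
by rewrite -ur1 -us1; apply: is_pushout_iso uv vu po1.
Qed.

End CoBoolean.
End Category.

Theorem corollary3p3 (C : category) (hC : co_boolean C) (X : C) :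
  projection_coextensive X.
Proof.
split=> [Y A f p proj_f proj_p|A1 A2 Y B1 B2 p1 p2 q1 q2 a1 f a2].
  have [P [r [q [po proj_q]]]] := cob_pushout hC f proj_p.
  exists P, r, q; split=> //.
  (* In the transposed square [r] is the leg opposite the projection [f]. *)
  exact: (pushout_projection hC proj_f proj_p (is_pushout_sym po)).
move=> prodp proj_a1 proj_f proj_a2 e1 e2.
split=> [prodq|[[po1 _ _] [po2 _ _]]].
  split; split=> //.
  - exact: (product_square_pushout hC prodp proj_f e1 e2 prodq).
  - exact: product_projectionl prodq.
  - exact: (product_square_pushout hC (is_product_sym prodp) proj_f e2 e1
              (is_product_sym prodq)).
  - exact: product_projectionr prodq.
exact: (cob_product hC prodp proj_f po1 po2).
Qed.
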